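(* Let $n,m\ge 3$ with $n,m\neq 4$. The proper (nontrivial) normal subgroups of $S_n\wr S_m$ are of the following types: (1) subgroups that act only on the second level (stabilizing the first level): $$E\wr\!\wr\,\widetilde A_m,\quad \widetilde T_m,\quad E\wr S_m,\quad E\wr A_m;$$ (2) subgroups that act on both levels: $$A_n\wr\!\wr\,\widetilde A_m,\quad S_n\wr\!\wr\,\widetilde A_m,\quad S_n\wr\!\wr\,\widetilde B_m,\quad A_n\wr S_m,$$ where $S_n\wr\!\wr\,\widetilde A_m\simeq S_n\ltimes P$, with $P\le S_m^n$ the subdirect product consisting of all $(b_1,\dots,b_n)\in S_m^n$ for which $\sum_{i=1}^n dec(b_i)$ is even. In total there are $10$ normal subgroups of $S_n\wr S_m$, of which $8$ are proper (different from the trivial subgroup and from the whole group).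
   Context: $S_n\wr S_m=S_n\ltimes S_m^{\,n}$ is the permutational wreath product with top group $S_n$ permuting the $n$ coordinates of the base $S_m^n$; its elements are written $\pi(b_1,\dots,b_n)$ with $\pi\in S_n$, $b_i\in S_m$, with multiplication $\sigma(b_1,\dots,b_n)\cdot\pi(a_1,\dots,a_n)=\sigma\pi(b_{\pi(1)}a_1,\dots,b_{\pi(n)}a_n)$. $E$ is the trivial group. The decrement of a permutation $\rho$ of degree $m$ is $dec(\rho)=m-(\text{number of cycles of }\rho)$, fixed points counted as cycles. For subgroups $G\le S_n$, $H\le S_m$, $G\wr H$ denotes the set of $\pi(b_1,\dots,b_n)$ with $\pi\in G$ and all $b_i\in H$. For $G\le S_n$, $G\wr\!\wr\,\widetilde A_m$ denotes the set of $\pi(b_1,\dots,b_n)$ with $\pi\in G$ and $\sum_{i=1}^n dec(b_i)$ even. $\widetilde T_m$ denotes the set of elements $e(b_1,\dots,b_n)$ with trivial top permutation such that either all $b_i\in A_m$ or all $b_i\in S_m\setminus A_m$. $S_n\wr\!\wr\,\widetilde B_m$ denotes the third subgroup of index $2$ in $S_n\wr S_m$, different from $S_n\wr\!\wr\,\widetilde A_m$ and $A_n\wr S_m$; that is, the set of $\pi(b_1,\dots,b_n)$ with $dec(\pi)+\sum_{i=1}^n dec(b_i)$ even. *)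

(* Defs.v *)
From HB Require Import structures.
From mathcomp Require Import all_boot all_fingroup all_solvable.

Set Implicit Arguments.
Unset Strict Implicit.
Unset Printing Implicit Defensive.

Local Open Scope group_scope.

(* The base group S_m^n, with the library's pointwise group structure. *)
Notation base_group n m := {dffun forall _ : 'I_n, 'S_m}.

(* Number of cycles is counted by [porbits], which includes the fixed points. *)
Definition dec m (s : 'S_m) : nat := (m - #|porbits s|)%N.

(* [Wreath pi b] is the element pi(b_1, ..., b_n) of S_n wr S_m. *)
Record wreath (n m : nat) : Type :=
  Wreath { top : 'S_n; coords : base_group n m }.

Section WreathGroup.
Variables n m : nat.
Local Notation W := (wreath n m).

Definition wreath_to_pair (w : W) : 'S_n * base_group n m := (top w, coords w).
Definition wreath_of_pair (p : 'S_n * base_group n m) : W := Wreath p.1 p.2.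

Lemma wreath_to_pairK : cancel wreath_to_pair wreath_of_pair.
Proof. by case. Qed.

HB.instance Definition _ := Finite.copy W (can_type wreath_to_pairK).

(* sigma(b_i) * pi(a_i) = (sigma pi)(b_{pi(i)} a_i), products of permutations
   being composed from right to left; the product [s * t] of mathcomp is
   x |-> t (s x), whence the reversed order of the factors below. *)
Definition wreath_mul (u v : W) : W :=
  Wreath (top v * top u) [ffun i => coords v i * coords u (top v i)].

Definition wreath_one : W := Wreath 1 [ffun=> 1].

Definition wreath_inv (u : W) : W :=
  Wreath (top u)^-1 [ffun i => (coords u ((top u)^-1 i))^-1].

Lemma wreath_mulA : associative wreath_mul.
Proof.
case=> s b [t c] [u d]; rewrite /wreath_mul /= mulgA; congr Wreath.
by apply/ffunP=> i; rewrite !ffunE permM mulgA.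
Qed.

Lemma wreath_mul1 : left_id wreath_one wreath_mul.
Proof.
case=> s b; rewrite /wreath_mul /= mulg1; congr Wreath.
by apply/ffunP=> i; rewrite !ffunE mulg1.
Qed.

Lemma wreath_mulV : left_inverse wreath_one wreath_inv wreath_mul.
Proof.
case=> s b; rewrite /wreath_mul /= mulgV; congr Wreath.
by apply/ffunP=> i; rewrite !ffunE permK mulgV.
Qed.

HB.instance Definition _ :=
  Finite_isGroup.Build W wreath_mulA wreath_mul1 wreath_mulV.

(* [wr G H], [wrwrA m G], [wrT n m] and [wrwrB n m] stand for G wr H,
   G wrwr ~A_m, ~T_m and S_n wrwr ~B_m. *)
Definition wr (G : {set 'S_n}) (H : {set 'S_m}) : {set W} :=
  [set w : W | (top w \in G) && [forall i, coords w i \in H]].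

Definition wrwrA (G : {set 'S_n}) : {set W} :=
  [set w : W | (top w \in G) && ~~ odd (\sum_i dec (coords w i))].

Definition wrT : {set W} :=
  [set w : W | (top w == 1) &&
     ([forall i, coords w i \in 'Alt_('I_m)] ||
      [forall i, coords w i \notin 'Alt_('I_m)])].

Definition wrwrB : {set W} :=
  [set w : W | ~~ odd (dec (top w) + \sum_i dec (coords w i))].

(* [w] acts on the two-level rooted tree by i |-> top w i on the first level
   and (i, x) |-> (top w i, coords w i x) on the second level. *)
Definition stabilizes_level1 (N : {set W}) : Prop :=
  forall w, w \in N -> forall i, top w i = i.

(* Requiring [top w] to be trivial excludes second-level moves that are
   merely induced by moves on the first level. *)
Definition acts_on_level2 (N : {set W}) : Prop :=
  exists w, [/\ w \in N, (forall i, top w i = i)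
                & exists i x, coords w i x != x].

(* Subgroups are encoded by their carriers; [N <| [set: W]] alone does not
   require [N] to be a subgroup. *)
Definition normal_subgroup (N : {set W}) : bool :=
  group_set N && (N <| [set: W]).

Definition proper_normal_subgroup (N : {set W}) : bool :=
  [&& normal_subgroup N, N != 1 & N != [set: W]].

Lemma odd_dec k (s : 'S_k) : odd (dec s) = odd_perm s.
Proof.
have le_k : #|porbits s| <= k.
  by rewrite -[leqRHS]card_ord /porbits; exact: leq_imset_card.
by rewrite /dec oddB // /odd_perm card_ord.
Qed.

Lemma odd_sum_dec (b : base_group n m) :
  odd (\sum_i dec (b i)) = \big[addb/false]_i odd_perm (b i).
Proof.
rewrite (big_morph odd oddD (erefl (odd 0))).
by apply: eq_bigr => i _; exact: odd_dec.
Qed.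

Definition even_base : {set base_group n m} :=
  [set b : base_group n m | ~~ odd (\sum_i dec (b i))].

Lemma even_base_group_set : group_set even_base.
Proof.
apply/group_setP; split=> [|b c]; rewrite !inE !odd_sum_dec.
  by rewrite big1 // => i _; rewrite ffunE odd_perm1.
move=> /negPf b0 /negPf c0.
rewrite (eq_bigr (fun i => odd_perm (b i) (+) odd_perm (c i))).
  by rewrite big_split /= b0 c0.
by move=> i _; rewrite ffunE odd_permM.
Qed.

Canonical even_base_group := Group even_base_group_set.

Definition subdirect (P : {set base_group n m}) : Prop :=
  group_set P /\ forall i, [set b i | b : base_group n m in P] = [set: 'S_m].

(* Right action of 'S_n on S_m^n permuting the coordinates; the inverse makes
   it a right action for the left-to-right product of permutations. *)
Definition permute_coords (b : base_group n m) (s : 'S_n) : base_group n m :=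
  [ffun i => b (s^-1 i)].

Lemma permute_coords1 : permute_coords^~ 1 =1 id.
Proof. by move=> b; apply/ffunP=> i; rewrite ffunE invg1 perm1. Qed.

Lemma permute_coordsM b : act_morph permute_coords b.
Proof. by move=> s t; apply/ffunP=> i; rewrite !ffunE invMg permM. Qed.

Definition coords_action := TotalAction permute_coords1 permute_coordsM.

Lemma coords_action_is_groupAction :
  is_groupAction [set: base_group n m] coords_action.
Proof.
move=> s _; rewrite inE; apply/andP; split.
  by apply/subsetP=> b; rewrite inE.
apply/morphicP=> b c _ _; rewrite !actpermE /=.
by apply/ffunP=> i; rewrite !ffunE.
Qed.

Definition coords_groupAction := GroupAction coords_action_is_groupAction.

Lemma coords_action_even :
  {acts [set: 'S_n], on group even_base | coords_groupAction}.
Proof.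
split; last exact: subsetT.
apply/subsetP=> s _; rewrite !inE /=; apply/subsetP=> b; rewrite !inE /=.
have bsE i : permute_coords b s (s i) = b i by rewrite ffunE permK.
suff -> : \sum_i dec (permute_coords b s i) = \sum_i dec (b i) by [].
rewrite (reindex_inj (@perm_inj _ s)) /=.
by apply: eq_bigr => i _; rewrite bsE.
Qed.

(* The external semidirect product S_n |x P with P = even_base. *)
Definition Sn_ltimes_even : finGroupType :=
  sdprod_by (actby_groupAction coords_action_even).

End WreathGroup.

Arguments wr {n m} G H.
Arguments wrwrA {n} m G.
Arguments wrT n m : clear implicits.
Arguments wrwrB n m : clear implicits.
Arguments even_base n m : clear implicits.
Arguments Sn_ltimes_even n m : clear implicits.

(* Main.v *)
Require Import Defs.
From mathcomp Require Import all_boot all_fingroup all_solvable.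

(** Write [N] for a normal subgroup of the wreath product and [M] for its
    intersection with the base group, seen as a group of families of
    permutations.  [M] is normal in the base and stable under permutation of
    the coordinates.

    If [M] is not trivial, a commutator with an element supported on one
    coordinate puts a nontrivial element supported on that coordinate into [M];
    the alternating group of degree [m] being simple, [M] then contains every
    family of even permutations ([contains_Alt_base]).  What is left of [M] is
    a submodule of the permutation module of dimension [n] over the field with
    two elements, and those are the zero submodule, the constant vectors, the
    vectors of even weight and the whole module ([contains_even_base],
    [invariant_base_cases]).  This settles the case where [N] acts trivially on
    the first level ([level1_normal_cases]).

    If [N] contains an element with a nontrivial top permutation, its
    commutators with the base show that [M] contains all families of even total
    parity ([top_contains_even_base]), and its commutators with the top group,
    together with the simplicity of the alternating group of degree [n], show
    that [N] contains all even top permutations ([contains_Alt_top]).  So [N]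
    contains the kernel of the homomorphism that sends an element to the sign
    of its top permutation and to the total parity of its coordinates.  The
    image of that homomorphism is a Klein four-group, whose five subgroups give
    the four types acting on both levels and the whole group
    ([level2_normal_cases]).

    Conversely all these sets are normal subgroups ([types_normal]), and a few
    explicit elements tell them apart ([uniq_all_types]), whence the two
    counts. *)

Set Implicit Arguments.
Unset Strict Implicit.
Unset Printing Implicit Defensive.

Local Open Scope group_scope.

(** * Normal subgroups of the symmetric group *)

Section SymmetricGroup.
Variable T : finType.
Hypothesis card_ge3 : 2 < #|T|.
Implicit Types (s t : {perm T}) (G : {group {perm T}}).

Lemma exists_odd_perm : exists t : {perm T}, odd_perm t.
Proof.
have /card_gt1P[x [y [_ _ neq_xy]]] : 1 < #|T| by exact: ltnW.
by exists (tperm x y); rewrite odd_tperm.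
Qed.

Lemma Alt_neq1 : exists2 t : {perm T}, t \in 'Alt_T & t != 1.
Proof.
have /card_gt2P[x [y [z [_ [xy yz zx]]]]] := card_ge3.
exists (tperm x y * tperm y z).
  by rewrite Alt_even odd_permM !odd_tperm xy yz.
apply: contraNneq zx => /permP/(_ x).
by rewrite perm1 permM tpermL tpermL => ->.
Qed.

Lemma exists_moved s : s != 1 -> exists x, s x != x.
Proof.
move=> s_neq1; apply/existsP; apply: contraR s_neq1 => /existsPn fix_s.
by apply/eqP/permP=> x; rewrite perm1; apply/eqP; rewrite -[_ == _]negbK.
Qed.

Lemma exists_third (x y : T) : exists z, (z != x) && (z != y).
Proof.
apply/existsP; apply: contraTT card_ge3 => /existsPn in_xy.
rewrite -leqNgt -(cardsT T).
apply: (@leq_trans #|[set x; y]|); last by rewrite cards2; case: (_ != _).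
apply/subset_leq_card/subsetP=> z _.
by rewrite !inE; have:= in_xy z; rewrite negb_and !negbK.
Qed.

Lemma noncommuting_perm s : s != 1 -> exists t, [~ s, t] != 1.
Proof.
move=> /exists_moved[x sx].
have [z /andP[zx zsx]] := exists_third x (s x).
exists (tperm x z); apply: contraNneq zx => /eqP/commgP/permP/(_ x).
by rewrite !permM tpermL tpermD // 1?eq_sym // => /perm_inj->.
Qed.

Hypothesis card_neq4 : #|T| != 4.

Lemma simple_Alt : simple 'Alt_T.
Proof.
have [T5 | T5] := leqP 5 #|T|; first exact: simple_Alt5.
apply: simple_Alt_3; move: card_ge3 card_neq4 T5.
by case: #|T| => [|[|[|[|[]]]]].
Qed.

(** A nontrivial [s] in [G] has a nontrivial commutator, which is an even
    permutation; hence [G] meets the simple group ['Alt_T] nontrivially. *)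
Lemma normal_Sym_contains_Alt G :
  [set: {perm T}] \subset 'N(G) -> G :!=: 1 -> 'Alt_T \subset G.
Proof.
move=> nG /trivgPn[s Gs s_neq1].
have nTG x : x \in 'N(G) by rewrite (subsetP nG) ?inE.
have [t st_neq1] := noncommuting_perm s_neq1.
have Gst : [~ s, t] \in G :&: 'Alt_T.
  rewrite inE Alt_even /commg odd_permM odd_permV odd_permJ addbb andbT.
  by rewrite groupM ?groupV ?memJ_norm.
case/simpleP: simple_Alt => _ /(_ (G :&: 'Alt_T)%G) [|GA1|GA].
- by rewrite /normal subsetIr normsI ?normG // (subset_trans (subsetT _)).
- by move: Gst; rewrite [_ :&: _]GA1 => /set1P st1; rewrite st1 eqxx in st_neq1.
- by rewrite -GA subsetIl.
Qed.

End SymmetricGroup.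

(** * Invariant normal subgroups of the base group *)

Section BaseGroup.
Variables n m : nat.
Local Notation B := (base_group n m).

(** A specialisation of [dfung1] to a constant family, so that its argument and
    value have types on which group structures are found. *)
Definition single (i : 'I_n) (x : 'S_m) : B :=
  @dfung1 _ (fun _ : 'I_n => 'S_m) i x.

Lemma singleE i x j : single i x j = if i == j then x else 1.
Proof.
have [<-|ij] := eqVneq i j; first exact: dfung1_id.
exact: dfung1_dflt.
Qed.

Lemma singleM i : {morph single i : x y / x * y}.
Proof. exact: dfung1_morphM. Qed.

Canonical single_morphism i := @Morphism _ _ setT _ (in2W (@singleM i)).

Lemma odd_single i t j : odd_perm t -> odd_perm (single i t j) = (i == j).
Proof. by rewrite singleE; case: eqP; rewrite ?odd_perm1. Qed.

Lemma prod_single (b : B) : \prod_i single i (b i) = b.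
Proof.
apply/ffunP=> k; rewrite prodg_ffun (big_only1 k) ?singleE ?eqxx //.
by move=> j jk _; rewrite singleE (negPf jk).
Qed.

Definition Alt_base : {set B} := [set b : B | [forall i, b i \in 'Alt_('I_m)]].

Definition equal_parity_base : {set B} :=
  [set b : B | [forall i, b i \in 'Alt_('I_m)] ||
               [forall i, b i \notin 'Alt_('I_m)]].

Lemma in_even_base (b : B) :
  (b \in even_base n m) = ~~ \big[addb/false]_i odd_perm (b i).
Proof. by rewrite inE odd_sum_dec. Qed.

Hypotheses (n_gt0 : 0 < n) (m_ge3 : 2 < m) (m_neq4 : m != 4).
Variable M : {group B}.
Hypothesis normM : [set: B] \subset 'N(M).
Hypothesis stableM : forall (b : B) s, b \in M -> permute_coords b s \in M.

Let cardm : 2 < #|'I_m|. Proof. by rewrite card_ord. Qed.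

Lemma single_permute i j x :
  permute_coords (single i x) (tperm i j) = single j x.
Proof.
apply/ffunP=> k; rewrite ffunE tpermV !singleE.
have [<-|jk] := eqVneq j k; first by rewrite tpermR eqxx.
rewrite ifN //.
case: tpermP => [ki | kj | /eqP ki _]; last by rewrite eq_sym.
  by rewrite -ki eq_sym.
by rewrite kj eqxx in jk.
Qed.

(** Commuting [b] with an element concentrated in coordinate [i] isolates that
    coordinate, where the normal subgroups of the symmetric group are known. *)
Lemma contains_Alt_base (b : B) : b \in M -> b != 1 -> Alt_base \subset M.
Proof.
move=> Mb b_neq1.
have [i bi_neq1] : exists i, b i != 1.
  apply/existsP; apply: contraR b_neq1 => /existsPn b1.
  by apply/eqP/ffunP=> i; rewrite ffunE; apply/eqP; rewrite -[_ == _]negbK.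
pose G := (single i @*^-1 M)%G.
have memG x : (x \in G) = (single i x \in M) by rewrite !inE.
have nG : [set: 'S_m] \subset 'N(G).
  apply/subsetP=> x _; rewrite inE; apply/subsetP=> _ /imsetP[y Gy ->].
  move: Gy; rewrite !memG /= morphJ ?inE // => My.
  by rewrite memJ_norm // (subsetP normM) ?inE.
have [|x bx_neq1] := @noncommuting_perm _ _ (b i) bi_neq1; first by [].
have Gbx : [~ b i, x] \in G.
  rewrite memG; have -> : single i [~ b i, x] = [~ b, single i x].
    apply/ffunP=> j; rewrite /commg /conjg !(mulg_ffun, invg_ffun).
    rewrite !singleE; case: eqP => [<- //|_].
    by rewrite invg1 mulg1 mul1g mulVg.
  by rewrite /commg groupM ?groupV // memJ_norm // (subsetP normM) ?inE.
have AG : 'Alt_('I_m) \subset G.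
  apply: normal_Sym_contains_Alt => //; first by rewrite card_ord.
  by apply/trivgPn; exists [~ b i, x].
apply/subsetP=> c; rewrite inE => /forallP Ac.
rewrite -(prod_single c) group_prod // => j _.
rewrite -(single_permute i) stableM // -memG.
exact: (subsetP AG) (Ac j).
Qed.

Lemma same_parity_mem (b c : B) :
  Alt_base \subset M -> b \in M ->
  (forall i, odd_perm (c i) = odd_perm (b i)) -> c \in M.
Proof.
move=> AM Mb bc; rewrite -(mulKVg b c) groupM // (subsetP AM) // inE.
by apply/forallP=> i; rewrite Alt_even !ffunE odd_permM odd_permV bc addbb.
Qed.

(** Modulo [Alt_base], [M] is a submodule of the permutation module over the
    field with two elements.  If [b] has different entries at [i] and [j], then
    the transposition of [i] and [j] changes it by the sum of two basis
    vectors; such sums span the vectors of even weight. *)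
Lemma contains_even_base (b : B) i j :
  b \in M -> odd_perm (b i) != odd_perm (b j) -> even_base n m \subset M.
Proof.
move=> Mb bij.
have neq_ij : i != j by apply: contraNneq bij => ->.
have AM : Alt_base \subset M.
  apply: contains_Alt_base Mb _; apply: contraNneq bij => ->.
  by rewrite !oneg_ffun.
have [t t_odd] := exists_odd_perm cardm.
pose pair k l : B := single k t * single l t.
have odd_pair k l q : odd_perm (pair k l q) = (k == q) (+) (l == q).
  by rewrite mulg_ffun odd_permM !odd_single.
have Mij : pair i j \in M.
  apply: (@same_parity_mem (permute_coords b (tperm i j) * b)) => //.
    by rewrite groupM ?stableM.
  move=> k; rewrite odd_pair !ffunE odd_permM tpermV.
  case: tpermP => [->|->|/eqP ik /eqP jk].
  - rewrite eqxx [j == i]eq_sym (negPf neq_ij).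
    by move: bij; do 2 case: odd_perm.
  - by rewrite eqxx (negPf neq_ij); move: bij; do 2 case: odd_perm.
  - by rewrite addbb eq_sym (negPf ik) eq_sym (negPf jk).
have Mpair k l : k != l -> pair k l \in M.
  move=> kl.
  (* A permutation that sends [i] to [k] and [j] to [l]. *)
  pose s := tperm i k * tperm (tperm i k j) l.
  have ikj : tperm i k j != k.
    apply: contraNneq neq_ij => jk.
    by rewrite -(inj_eq (@perm_inj _ (tperm i k))) tpermL jk.
  have si : s i = k by rewrite permM tpermL tpermD // eq_sym.
  have sj : s j = l by rewrite permM tpermL.
  apply: (@same_parity_mem (permute_coords (pair i j) s)) => //.
    exact: stableM.
  move=> q; rewrite odd_pair ffunE odd_pair -si -sj.
  by rewrite -!(inj_eq (@perm_inj _ s) _ (s^-1 q)) permKV.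
apply/subsetP=> c; rewrite in_even_base => c_even.
(* Pairing each odd coordinate of [c] with [i] gets every coordinate other than
   [i] right; coordinate [i] is then right because [c] has even weight. *)
pose p := \prod_(k | (k != i) && odd_perm (c k)) pair k i.
apply: (@same_parity_mem p) => //.
  by apply: group_prod => k /andP[ki _]; exact: Mpair.
move=> q; rewrite /p prodg_ffun (big_morph _ (@odd_permM _) (@odd_perm1 _)).
under eq_bigr do rewrite odd_pair.
have [<-{q}|iq] := eqVneq i q.
  have /(congr1 (addb (odd_perm (c i)))) := negPf c_even.
  rewrite (bigD1 i) //= addKb addbF => <-; rewrite big_mkcondr.
  apply: eq_bigr => k ki.
  by rewrite (negPf ki); case: odd_perm.
case c_odd: (odd_perm (c q)).
  rewrite (big_only1 q) ?eqxx ?c_odd // 1?eq_sym ?iq //.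
  by move=> k /negPf->.
rewrite big1 // => k /andP[_ ck]; rewrite addbF.
by apply: contraTF ck => /eqP->; rewrite c_odd.
Qed.

Lemma invariant_base_cases :
  M :=: 1 \/ gval M \in [:: Alt_base; equal_parity_base; even_base n m; setT].
Proof.
have [->|/trivgPn[b0 Mb0 b0_neq1]] := eqVneq (gval M) 1; [by left | right].
have AM := contains_Alt_base Mb0 b0_neq1.
have [/forall_inP constM|] :=
    boolP [forall b in M, forall i, forall j, odd_perm (b i) == odd_perm (b j)].
  pose i0 : 'I_n := Ordinal n_gt0.
  have eq_i0 b i : b \in M -> odd_perm (b i) = odd_perm (b i0).
    by move=> /constM/forallP/(_ i)/forallP/(_ i0)/eqP.
  have [c /andP[Mc /= c_odd]|even_M] := pickP [pred c in M | odd_perm (c i0)].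
    have -> : gval M = equal_parity_base; last by rewrite !inE eqxx orbT.
    apply/setP=> b; rewrite inE; apply/idP/orP.
      move=> Mb; case b_odd: (odd_perm (b i0)); [right | left];
        by apply/forallP=> i; rewrite Alt_even eq_i0 // b_odd.
    case=> [Ab | /forallP Nb]; first by rewrite (subsetP AM) ?inE.
    apply: (same_parity_mem AM Mc) => i; rewrite (eq_i0 c i) // c_odd.
    by have:= Nb i; rewrite Alt_even negbK.
  have -> : gval M = Alt_base; last by rewrite !inE eqxx.
  apply/eqP; rewrite eqEsubset AM andbT; apply/subsetP=> b Mb; rewrite inE.
  apply/forallP=> i; rewrite Alt_even eq_i0 //.
  by have /negbT := even_M b; rewrite /= Mb.
rewrite negb_forall_in => /exists_inP[b Mb].
rewrite negb_forall => /existsP[i]; rewrite negb_forall => /existsP[j bij].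
have EM := contains_even_base Mb bij.
have [/subsetP ME | /subsetPn[c Mc c_odd]] :=
    boolP (gval M \subset even_base n m).
  have -> : gval M = even_base n m; last by rewrite !inE eqxx !orbT.
  by apply/eqP; rewrite eqEsubset EM andbT; apply/subsetP.
have -> : gval M = setT; last by rewrite !inE eqxx !orbT.
apply/setP=> d; rewrite inE; have [Ed|Nd] := boolP (d \in even_base n m).
  exact: (subsetP EM).
rewrite -(mulKVg c d) groupM // (subsetP EM) //.
rewrite !in_even_base !negbK in c_odd Nd *.
under eq_bigr do rewrite mulg_ffun invg_ffun odd_permM odd_permV.
by rewrite big_split /= c_odd Nd.
Qed.

End BaseGroup.

(** * Normal subgroups of the wreath product *)

Section WreathProduct.
Variables n m : nat.
Local Notation W := (wreath n m).
Local Notation B := (base_group n m).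
Implicit Types (u v w : W) (b c : B) (s t : 'S_n).

Lemma wreath_eq u v : top u = top v -> coords u =1 coords v -> u = v.
Proof. by case: u v => [s b] [t c] /= -> /ffunP->. Qed.

Lemma topM u v : top (u * v) = top v * top u. Proof. by []. Qed.
Lemma topV u : top u^-1 = (top u)^-1. Proof. by []. Qed.

Lemma topJ u v : top (u ^ v) = top u ^ (top v)^-1.
Proof. by rewrite /conjg !topM topV invgK mulgA. Qed.

Lemma coordsM u v i : coords (u * v) i = coords v i * coords u (top v i).
Proof. by rewrite ffunE. Qed.

Lemma coordsV u i : coords u^-1 i = (coords u ((top u)^-1 i))^-1.
Proof. by rewrite ffunE. Qed.

Lemma coords1 i : coords (1 : W) i = 1.
Proof. by rewrite ffunE. Qed.

Lemma coordsJ u v i :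
  top u = 1 -> coords (u ^ v) i = coords u (top v i) ^ (coords v i)^-1.
Proof.
move=> u1; rewrite /conjg !coordsM coordsV topM u1 mulg1 permK invgK.
by rewrite mulgA.
Qed.

Definition parity w : bool := \big[addb/false]_i odd_perm (coords w i).

Lemma odd_dec_coords w : odd (\sum_i dec (coords w i)) = parity w.
Proof. exact: odd_sum_dec. Qed.

Lemma parityM u v : parity (u * v) = parity u (+) parity v.
Proof.
rewrite /parity; under eq_bigr do rewrite coordsM odd_permM.
by rewrite big_split /= addbC [in RHS](reindex_inj (@perm_inj _ (top v))).
Qed.

Lemma parity1 : parity 1 = false.
Proof. by rewrite /parity big1 // => i _; rewrite coords1 odd_perm1. Qed.

Lemma parityV u : parity u^-1 = parity u.
Proof.
have := parityM u^-1 u; rewrite mulVg parity1.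
by case: (parity u^-1) (parity u) => [] [].
Qed.

Lemma parityJ u v : parity (u ^ v) = parity u.
Proof. by rewrite /conjg !parityM parityV addbCA addbb addbF. Qed.

Lemma parity_top s : parity (Wreath s 1 : W) = false.
Proof. by rewrite /parity big1 // => i _; rewrite oneg_ffun odd_perm1. Qed.

Lemma parity_base s i (t : 'S_m) :
  odd_perm t -> parity (Wreath s (single i t)).
Proof.
move=> t_odd; rewrite /parity (big_only1 i) ?odd_single ?eqxx //.
by move=> j ji _; rewrite odd_single // eq_sym (negPf ji).
Qed.

Lemma in_wr_full (G : {set 'S_n}) w : (w \in wr G [set: 'S_m]) = (top w \in G).
Proof.
rewrite inE.
have -> : [forall i, coords w i \in [set: 'S_m]]; last exact: andbT.
by apply/forallP=> i; rewrite inE.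
Qed.

Lemma in_wrwrA (G : {set 'S_n}) w :
  (w \in wrwrA m G) = (top w \in G) && ~~ parity w.
Proof. by rewrite inE odd_dec_coords. Qed.

Lemma in_wrwrB w : (w \in wrwrB n m) = ~~ (odd_perm (top w) (+) parity w).
Proof. by rewrite inE oddD odd_dec odd_dec_coords. Qed.

Section NormalSubgroup.
Variable N : {group W}.
Hypothesis normN : [set: W] \subset 'N(N).

Lemma memJN w v : w \in N -> w ^ v \in N.
Proof. by move=> Nw; rewrite memJ_norm // (subsetP normN) ?inE. Qed.

Lemma memRN w v : w \in N -> [~ w, v] \in N.
Proof. by move=> Nw; rewrite /commg groupM ?groupV ?memJN. Qed.

Definition base_trace : {set B} := [set b | Wreath 1 b \in N].

Lemma base_trace_group_set : group_set base_trace.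
Proof.
apply/group_setP; split=> [|b c]; rewrite !inE; first exact: group1.
move=> Nb Nc; suff -> : Wreath 1 (b * c) = Wreath 1 c * Wreath 1 b.
  by rewrite groupM.
apply: wreath_eq => [|i] /=; first by rewrite mulg1.
by rewrite !ffunE perm1.
Qed.
Canonical base_trace_group := Group base_trace_group_set.

Lemma base_trace_norm : [set: B] \subset 'N(base_trace).
Proof.
apply/subsetP=> c _; rewrite inE; apply/subsetP=> _ /imsetP[b Nb ->].
rewrite !inE in Nb *.
suff -> : Wreath 1 (b ^ c) = Wreath 1 b ^ Wreath 1 c^-1 by exact: memJN.
apply: wreath_eq => [|i]; first by rewrite topJ /= conj1g.
by rewrite coordsJ //= perm1 /conjg !ffunE !invgK.
Qed.

Lemma base_trace_permute b s :
  b \in base_trace -> permute_coords b s \in base_trace.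
Proof.
rewrite !inE => Nb.
suff -> : Wreath 1 (permute_coords b s) = Wreath 1 b ^ Wreath s^-1 1.
  exact: memJN.
apply: wreath_eq => [|i]; first by rewrite topJ /= conj1g.
by rewrite coordsJ //= !ffunE invg1 conjg1.
Qed.

Hypotheses (n_ge3 : 2 < n) (m_ge3 : 2 < m) (m_neq4 : m != 4).

Let card_n : 2 < #|'I_n|. Proof. by rewrite card_ord. Qed.
Let card_m : 2 < #|'I_m|. Proof. by rewrite card_ord. Qed.

Lemma level1_normal_cases :
  (forall w, w \in N -> top w = 1) ->
  N :=: 1 \/ gval N \in [:: wrwrA m 1; wrT n m; wr 1 [set: 'S_m];
                            wr 1 'Alt_('I_m)].
Proof.
move=> topN.
have memN w : (w \in N) = (top w == 1) && (coords w \in base_trace).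
  rewrite inE; have [w1|w_neq1] := eqVneq; last first.
    by apply: contraNF w_neq1 => /topN->.
  by rewrite -w1; case: (w).
case: (@invariant_base_cases _ _ (ltnW (ltnW n_ge3)) m_ge3 m_neq4 _
         base_trace_norm base_trace_permute) => [/= M1|].
  left; apply/setP=> w; rewrite memN M1 !inE.
  apply/andP/eqP => [[/eqP w1 /eqP b1]|->].
    by apply: wreath_eq => [//|i]; rewrite b1 !ffunE.
  by split=> //; apply/eqP/ffunP=> i; rewrite coords1 ffunE.
rewrite !inE => ME; right.
have mem_type M' (N' : {set W}) : base_trace == M' ->
    (forall w, (w \in N') = (top w == 1) && (coords w \in M')) -> gval N == N'.
  by move=> /eqP MM' N'E; apply/eqP/setP=> w; rewrite memN MM' N'E.
case/or4P: ME => /mem_type NE; apply/or4P.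
- by apply: Or44; apply: NE => w; rewrite !inE.
- by apply: Or42; apply: NE => w; rewrite !inE.
- by apply: Or41; apply: NE => w; rewrite !inE.
- by apply: Or43; apply: NE => w; rewrite in_wr_full !inE andbT.
Qed.

(** Commuting an element that moves [i] on the first level with an odd
    permutation placed in coordinate [i] gives an element of the base that is
    odd at [i] and at the preimage of [i] only.  As there is a third coordinate,
    its parities are not all equal. *)
Lemma top_contains_even_base w :
  w \in N -> top w != 1 -> even_base n m \subset base_trace.
Proof.
move=> Nw /exists_moved[i wi].
have [t t_odd] := exists_odd_perm card_m.
pose v : W := Wreath 1 (single i t).
have [k /andP[ki kwi]] := exists_third card_n i ((top w)^-1 i).
have wv1 : top [~ w, v] = 1.
  by rewrite /commg topM topV topJ invg1 conjg1 mulgV.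
have odd_wv j : odd_perm (coords [~ w, v] j) = (i == j) (+) (i == top w j).
  rewrite /commg coordsM coordsV /conjg !coordsM coordsV.
  rewrite !topM !topV /= invg1 mulg1 mul1g perm1 permK.
  rewrite !(odd_permM, odd_permV) perm1 !odd_single //.
  by case: (odd_perm (coords w j)); do 2 case: (i == _).
have Nwv : coords [~ w, v] \in base_trace.
  rewrite inE; suff -> : Wreath 1 (coords [~ w, v]) = [~ w, v] by exact: memRN.
  by apply: wreath_eq.
apply: (contains_even_base m_ge3 m_neq4 base_trace_norm base_trace_permute
          (i := i) (j := k) Nwv).
rewrite !odd_wv eqxx ![i == _]eq_sym (negPf wi) (negPf ki).
by rewrite (can2_eq (permK _) (permKV _)) (negPf kwi).
Qed.

Section MovesFirstLevel.
Hypothesis n_neq4 : n != 4.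
Variable w0 : W.
Hypotheses (Nw0 : w0 \in N) (top_w0 : top w0 != 1).

Let evenN := top_contains_even_base Nw0 top_w0.

Lemma same_top_parity_mem u v :
  u \in N -> top v = top u -> parity v = parity u -> v \in N.
Proof.
move=> Nu vu_top vu_par; rewrite -(mulKVg u v) groupM //.
have -> : u^-1 * v = Wreath 1 (coords (u^-1 * v)).
  by apply: wreath_eq => //; rewrite topM topV vu_top mulgV.
have: coords (u^-1 * v) \in even_base n m.
  by rewrite in_even_base -/(parity _) parityM parityV vu_par addbb.
by move/(subsetP evenN); rewrite inE.
Qed.

(** A commutator with an element of the top group has parity zero, so the
    elements of parity zero in [N] still move the first level. *)
Lemma contains_Alt_top s : s \in 'Alt_('I_n) -> Wreath s 1 \in N.
Proof.
pose G := [set t | Wreath t 1 \in N].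
have gG : group_set G.
  apply/group_setP; split=> [|t t']; rewrite !inE; first exact: group1.
  move=> Nt Nt'.
  suff -> : Wreath (t * t') 1 = Wreath t' 1 * Wreath t 1 :> W by rewrite groupM.
  by apply: wreath_eq => //= i; rewrite !ffunE mulg1.
have nG : [set: 'S_n] \subset 'N(Group gG).
  apply/subsetP=> t _; rewrite inE; apply/subsetP=> _ /imsetP[t' Nt' ->].
  rewrite !inE in Nt' *; have := memJN (Wreath t^-1 1) Nt'.
  move/same_top_parity_mem; apply; first by rewrite topJ /= invgK.
  by rewrite parityJ !parity_top.
have [t st_neq1] := noncommuting_perm card_n top_w0.
have GR : [~ t^-1, (top w0)^-1] \in G.
  rewrite inE; apply: same_top_parity_mem (memRN (Wreath t 1) Nw0) _ _.
    by rewrite /commg /conjg !topM !topV /= !invgK !mulgA.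
  by rewrite /commg parityM parityV parityJ addbb parity_top.
have AG : 'Alt_('I_n) \subset Group gG.
  apply: normal_Sym_contains_Alt => //; first by rewrite card_ord.
  apply/trivgPn; exists [~ t^-1, (top w0)^-1] => //.
  apply: contraNneq st_neq1 => /eqP/commgP/commuteV/commute_sym/commuteV/commgP.
  by rewrite !invgK.
by move/(subsetP AG); rewrite inE.
Qed.

Lemma same_class_mem u v : u \in N ->
  odd_perm (top v) = odd_perm (top u) -> parity v = parity u -> v \in N.
Proof.
move=> Nu vu_odd vu_par; rewrite -(mulgKV u v) groupM //.
apply: (@same_top_parity_mem (Wreath (top (v * u^-1)) 1)) => //.
  apply: contains_Alt_top.
  by rewrite Alt_even topM topV odd_permM odd_permV vu_odd addbb.
by rewrite parityM parityV vu_par addbb parity_top.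
Qed.

(** [N] contains the kernel of the homomorphism given by the sign of the top
    permutation and the parity, so it is the preimage of one of the five
    subgroups of a Klein four-group: [a], [b] and [c] record which of the three
    nontrivial classes [N] contains. *)
Lemma level2_normal_cases :
  N :=: setT \/ gval N \in [:: wrwrA m 'Alt_('I_n); wrwrA m [set: 'S_n];
                               wrwrB n m; wr 'Alt_('I_n) [set: 'S_m]].
Proof.
have [tn tn_odd] := exists_odd_perm card_n.
have [tm tm_odd] := exists_odd_perm card_m.
(* Representatives of the four classes for the sign and the parity. *)
pose r p q : W := Wreath (if p then tn else 1)
  (if q then single (Ordinal (ltnW (ltnW n_ge3))) tm else 1).
have r_top p q : odd_perm (top (r p q)) = p by case: p; rewrite //= odd_perm1.
have r_par p q : parity (r p q) = q.
  by case: q; [exact: parity_base | exact: parity_top].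
have memN w : (w \in N) = (r (odd_perm (top w)) (parity w) \in N).
  by apply/idP/idP => /same_class_mem; apply; rewrite ?r_top ?r_par.
have r00 : r false false \in N by rewrite (_ : r _ _ = 1) ?group1.
have rM p q p' q' :
    r p q \in N -> r p' q' \in N -> r (p (+) p') (q (+) q') \in N.
  move=> Nr Nr'; apply: same_class_mem (groupM Nr Nr') _ _.
    by rewrite topM odd_permM !r_top addbC.
  by rewrite parityM !r_par.
rewrite !inE.
have [a|/negPf a] := boolP (r true false \in N);
have [b|/negPf b] := boolP (r false true \in N).
- left; apply/setP=> w; rewrite inE memN.
  move: (odd_perm _) (parity _) => [] [] //.
  exact: (rM _ _ _ _ a b).
- right; apply/or4P/Or42/eqP/setP=> w; rewrite memN in_wrwrA in_setT.
  have c : r true true \in N = false.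
    by apply: contraFF b => c; exact: (rM _ _ _ _ a c).
  by move: (odd_perm _) (parity _) => [] [].
- right; apply/or4P/Or44/eqP/setP=> w; rewrite memN in_wr_full Alt_even.
  have c : r true true \in N = false.
    by apply: contraFF a => c; exact: (rM _ _ _ _ b c).
  by move: (odd_perm _) (parity _) => [] [].
- have [c|/negPf c] := boolP (r true true \in N).
    right; apply/or4P/Or43/eqP/setP=> w; rewrite memN in_wrwrB.
    by move: (odd_perm _) (parity _) => [] [].
  right; apply/or4P/Or41/eqP/setP=> w; rewrite memN in_wrwrA Alt_even.
  by move: (odd_perm _) (parity _) => [] [].
Qed.

End MovesFirstLevel.
End NormalSubgroup.
End WreathProduct.

(** * Normality of the listed subgroups *)

Section Subgroups.
Variables n m : nat.
Local Notation W := (wreath n m).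
Implicit Types (u v w : W) (N : {set W}).

Lemma normal_subgroupI N : 1 \in N ->
    (forall u v, u \in N -> v \in N -> u * v \in N) ->
    (forall u v, u \in N -> u ^ v \in N) ->
  normal_subgroup N.
Proof.
move=> N1 NM NJ; apply/andP; split.
  by apply/group_setP; split=> // u v; exact: NM.
rewrite /normal subsetT; apply/subsetP=> v _; rewrite inE.
by apply/subsetP=> _ /imsetP[u Nu ->]; exact: NJ.
Qed.

Lemma normal_subgroup1 : normal_subgroup (1 : {set W}).
Proof. by rewrite /normal_subgroup groupP normal1. Qed.

Lemma normal_subgroupT : normal_subgroup [set: W].
Proof. by rewrite /normal_subgroup groupP normal_refl. Qed.

Lemma wrTP w :
  reflect (top w = 1 /\ exists e, forall i, odd_perm (coords w i) = e)
          (w \in wrT n m).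
Proof.
rewrite inE; apply: (iffP andP) => [[/eqP w1 /orP[]/forallP we]|[-> [[] we]]].
- by split=> //; exists false => i; have:= we i; rewrite Alt_even => /negbTE.
- by split=> //; exists true => i; have:= we i; rewrite Alt_even negbK.
- by split=> //; apply/orP; right; apply/forallP=> i; rewrite Alt_even we.
- by split=> //; apply/orP; left; apply/forallP=> i; rewrite Alt_even we.
Qed.

Lemma wr_full_normal (G : {group 'S_n}) :
  [set: 'S_n] \subset 'N(G) -> normal_subgroup (wr G [set: 'S_m]).
Proof.
move=> nG; apply: normal_subgroupI => [|u v|u v]; rewrite !in_wr_full.
- exact: group1.
- by rewrite topM => Gu Gv; exact: groupM.
- by move=> Gu; rewrite topJ memJ_norm // (subsetP nG) ?inE.
Qed.

Lemma wrwrA_normal (G : {group 'S_n}) :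
  [set: 'S_n] \subset 'N(G) -> normal_subgroup (wrwrA m G).
Proof.
move=> nG; apply: normal_subgroupI => [|u v|u v]; rewrite !in_wrwrA.
- by rewrite group1 parity1.
- move=> /andP[Gu /negPf pu] /andP[Gv /negPf pv].
  by rewrite topM groupM //= parityM pu pv.
- by rewrite topJ parityJ memJ_norm // (subsetP nG) ?inE.
Qed.

Lemma wrwrB_normal : normal_subgroup (wrwrB n m).
Proof.
apply: normal_subgroupI => [|u v|u v]; rewrite !in_wrwrB.
- by rewrite odd_perm1 parity1.
- rewrite topM odd_permM parityM.
  move: (odd_perm (top u)) (odd_perm (top v)) (parity u) (parity v).
  by move=> [] [] [] [].
- by rewrite topJ odd_permJ parityJ.
Qed.

Lemma wr1_normal (H : {group 'S_m}) :
  [set: 'S_m] \subset 'N(H) -> normal_subgroup (wr (1 : {set 'S_n}) H).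
Proof.
move=> nH; have wrP w :
    reflect (top w = 1 /\ forall i, coords w i \in H) (w \in wr 1 H).
  by rewrite !inE; apply: (iffP andP) => -[/eqP w1 /forallP wH].
apply: normal_subgroupI => [|u v /wrP[u1 uH] /wrP[v1 vH]|u v /wrP[u1 uH]];
  apply/wrP.
- by split=> // i; rewrite coords1.
- by split=> [|i]; rewrite ?topM ?u1 ?v1 ?mulg1 // coordsM groupM.
- split=> [|i]; first by rewrite topJ u1 conj1g.
  by rewrite coordsJ // memJ_norm // (subsetP nH) ?inE.
Qed.

Lemma wrT_normal : normal_subgroup (wrT n m).
Proof.
apply: normal_subgroupI => [|u v|u v]; last 2 first.
- move=> /wrTP[u1 [e ue]] /wrTP[v1 [f vf]]; apply/wrTP.
  split; first by rewrite topM u1 v1 mulg1.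
  by exists (f (+) e) => i; rewrite coordsM odd_permM ue vf.
- move=> /wrTP[u1 [e ue]]; apply/wrTP; split; first by rewrite topJ u1 conj1g.
  by exists e => i; rewrite coordsJ // odd_permJ ue.
by apply/wrTP; split=> //; exists false => i; rewrite coords1 odd_perm1.
Qed.

Lemma Alt_normT k : [set: 'S_k] \subset 'N('Alt_('I_k)).
Proof. exact: (Alt_norm 'I_k). Qed.

End Subgroups.

(** * The semidirect product with the even part of the base *)

Section Isomorphism.
Variables n m : nat.
Local Notation W := (wreath n m).
Local Notation S := (Sn_ltimes_even n m).

Lemma subdirect_even_base : 1 < n -> subdirect (even_base n m).
Proof.
move=> n_gt1; split=> [|i]; first exact: even_base_group_set.
apply/setP=> x; rewrite inE; apply/imsetP.
have [j ij] : exists j : 'I_n, i != j.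
  pose i0 : 'I_n := Ordinal (ltnW n_gt1); pose i1 : 'I_n := Ordinal n_gt1.
  by have [->|] := eqVneq i i0; [exists i1 | exists i0].
(* Repeating [x] in a second coordinate makes the total parity even. *)
exists (single i x * single j x); last first.
  by rewrite mulg_ffun !singleE eqxx eq_sym (negPf ij) mulg1.
rewrite in_even_base (bigD1 i) //= (bigD1 j) 1?eq_sym //=.
rewrite big1 => [|k /andP[ki kj]].
  rewrite !mulg_ffun !singleE !eqxx (negPf ij) eq_sym (negPf ij).
  by rewrite mulg1 mul1g addbF addbb.
rewrite mulg_ffun !singleE eq_sym (negPf ki) eq_sym (negPf kj).
by rewrite mulg1 odd_perm1.
Qed.

(** The product of the wreath product composes its right factor first, both on
    top and in each coordinate, while the semidirect product multiplies from
    left to right; inverting both components reconciles the two orders. *)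
Definition wreath_to_sdprod (w : W) : S :=
  insubd (1 : S) ((top w)^-1, (coords w)^-1).

Lemma wreath_to_sdprodE w : w \in wrwrA m [set: 'S_n] ->
  val (wreath_to_sdprod w) = ((top w)^-1, (coords w)^-1).
Proof.
rewrite in_wrwrA => /andP[_ pw]; rewrite val_insubd inE /= in_setT groupV.
by rewrite in_even_base pw.
Qed.

Lemma wreath_to_sdprodM :
  {in wrwrA m [set: 'S_n] &, {morph wreath_to_sdprod : u v / u * v}}.
Proof.
move=> u v Au Av; apply: val_inj; rewrite wreath_to_sdprodE; last first.
  by move: Au Av; rewrite !in_wrwrA !in_setT parityM => /negPf-> /negPf->.
rewrite /= /actby !wreath_to_sdprodE //= groupV !in_setT invMg andbT.
have -> : coords u \in even_base n m.
  by move: Au; rewrite in_wrwrA in_setT in_even_base.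
by congr (_, _); apply/ffunP=> i; rewrite !ffunE invMg invgK.
Qed.

Lemma wrwrA_isog_sdprod :
  wrwrA m [set: 'S_n] \isog [set: Sn_ltimes_even n m].
Proof.
have [gA _] := andP (@wrwrA_normal n m [set: 'S_n]%G (normG _)).
pose f := @Morphism _ _ (Group gA) _ wreath_to_sdprodM.
suff: Group gA \isog [set: S] by [].
apply/isogP; exists f.
  apply/injmP=> u v Au Av /(congr1 val).
  rewrite /= !wreath_to_sdprodE // => -[/invg_inj uv_top /invg_inj uv_coords].
  by apply: wreath_eq => // i; rewrite uv_coords.
apply/setP=> -[[s b] sb_in]; have /setXP[_ b_even] := sb_in.
rewrite inE; apply/morphimP.
have Aw : Wreath s^-1 b^-1 \in wrwrA m [set: 'S_n].
  rewrite in_wrwrA in_setT.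
  by rewrite -(groupV (even_base_group n m)) in_even_base in b_even.
exists (Wreath s^-1 b^-1) => //; apply: val_inj.
by rewrite /= wreath_to_sdprodE //= !invgK.
Qed.

End Isomorphism.

(** * Distinctness of the types *)

Section Types.
Variables n m : nat.
Hypotheses (n_ge3 : 2 < n) (m_ge3 : 2 < m).
Local Notation W := (wreath n m).

Definition level1_types : seq {set W} :=
  [:: wrwrA m 1; wrT n m; wr 1 [set: 'S_m]; wr 1 'Alt_('I_m)].
Definition level2_types : seq {set W} :=
  [:: wrwrA m 'Alt_('I_n); wrwrA m [set: 'S_n]; wrwrB n m;
      wr 'Alt_('I_n) [set: 'S_m]].

Lemma types_normal N : N \in level1_types ++ level2_types -> normal_subgroup N.
Proof.
have nT k : [set: 'S_k] \subset 'N([set: 'S_k]) by exact: normG.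
have n1 : [set: 'S_n] \subset 'N(1) by exact: norms1.
rewrite mem_cat !inE.
case/orP=> /or4P[]/eqP->;
  [ exact: (@wrwrA_normal _ _ 1%G) | exact: wrT_normal
  | exact: (@wr1_normal _ _ [set: 'S_m]%G)
  | exact: (@wr1_normal _ _ 'Alt_('I_m)%G (@Alt_normT m))
  | exact: (@wrwrA_normal _ _ 'Alt_('I_n)%G (@Alt_normT n))
  | exact: (@wrwrA_normal _ _ [set: 'S_n]%G) | exact: wrwrB_normal
  | exact: (@wr_full_normal _ _ 'Alt_('I_n)%G (@Alt_normT n)) ].
Qed.

Lemma types_contain_single_Alt N i x : x \in 'Alt_('I_m) ->
  N \in level1_types ++ level2_types -> Wreath 1 (single i x) \in N.
Proof.
move=> Ax; have Aix j : single i x j \in 'Alt_('I_m).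
  by move: Ax; rewrite !Alt_even singleE; case: eqP; rewrite ?odd_perm1.
have px : parity (Wreath 1 (single i x) : W) = false.
  rewrite /parity big1 // => j _; apply: negbTE.
  by rewrite -Alt_even; exact: Aix.
rewrite mem_cat !inE => /orP[]/or4P[]/eqP->;
  rewrite ?in_wrwrA ?in_wrwrB ?in_wr_full ?px ?odd_perm1 ?group1 //.
  apply/wrTP; split=> //; exists false => j.
  by apply: negbTE; rewrite -Alt_even; exact: Aix.
by rewrite !inE eqxx; apply/forallP.
Qed.

Lemma level2_types_contain_Alt_top N s : s \in 'Alt_('I_n) ->
  N \in level2_types -> Wreath s 1 \in N.
Proof.
move=> As; rewrite !inE => /or4P[]/eqP->;
  rewrite ?in_wrwrA ?in_wrwrB ?in_wr_full /= ?parity_top ?As ?in_setT //.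
by rewrite addbF -Alt_even.
Qed.

(** The sets are told apart by their membership tests on six elements: two odd
    coordinates ([d]), one odd coordinate ([b]), all coordinates odd ([c]), an
    even top ([e]), an odd top ([f]), an odd top with one odd coordinate ([g]).
    Membership only depends on [data] and [parity]; the parity of [c] is that of
    [n], and the tests succeed in both cases. *)
Lemma uniq_types : uniq (setT :: level1_types ++ level2_types).
Proof.
have card_n : 2 < #|'I_n| by rewrite card_ord.
have card_m : 2 < #|'I_m| by rewrite card_ord.
have [/= s s_even s_neq1] := Alt_neq1 card_n.
have [/= t t_odd] := exists_odd_perm card_n.
have [/= x x_odd] := exists_odd_perm card_m.
pose i0 : 'I_n := Ordinal (ltnW (ltnW n_ge3)).
have [i1 /andP[i10 _]] := exists_third card_n i0 i0.
have [i2 /andP[i20 i21]] := exists_third card_n i0 i1.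
pose even_coords (w : W) := [forall i, coords w i \in 'Alt_('I_m)].
pose odd_coords (w : W) := [forall i, coords w i \notin 'Alt_('I_m)].
pose data (w : W) :=
  (top w == 1, odd_perm (top w), even_coords w, odd_coords w).
have forall_false (P : pred 'I_n) i : P i = false -> [forall j, P j] = false.
  by move=> Pi; apply/negbTE/forallPn; exists i; rewrite Pi.
have even1 s' : even_coords (Wreath s' 1).
  by apply/forallP=> i; rewrite oneg_ffun group1.
have odd1 s' : odd_coords (Wreath s' 1) = false.
  by apply: (forall_false _ i0); rewrite oneg_ffun group1.
have even_b s' : even_coords (Wreath s' (single i0 x)) = false.
  by apply: (forall_false _ i0); rewrite /= Alt_even odd_single ?eqxx.
have odd_b s' : odd_coords (Wreath s' (single i0 x)) = false.
  apply: (forall_false _ i1).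
  by rewrite /= Alt_even odd_single // eq_sym (negPf i10).
have t_neq1 : t != 1 by apply: contraTneq t_odd => ->; rewrite odd_perm1.
have s_odd : odd_perm s = false by apply: negbTE; rewrite -Alt_even.
have [d [pd [d1 d2 d3 d4]]] :
    exists w, parity w = false /\ data w = (true, false, false, false).
  pose d := Wreath 1 (single i0 x) * Wreath 1 (single i1 x) : W.
  exists d; split.
    by rewrite parityM !parity_base.
  have dE j : odd_perm (coords d j) = (i1 == j) (+) (i0 == j).
    by rewrite coordsM odd_permM perm1 !odd_single.
  rewrite /data topM mulg1 eqxx odd_perm1 /even_coords /odd_coords.
  rewrite (forall_false _ i0) 1?(forall_false _ i2) // Alt_even dE.
    by rewrite ![_ == i2]eq_sym (negPf i20) (negPf i21).
  by rewrite eqxx (negPf i10).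
have [b [pb [b1 b2 b3 b4]]] :
    exists w, parity w = true /\ data w = (true, false, false, false).
  exists (Wreath 1 (single i0 x)); rewrite parity_base // /data even_b odd_b.
  by rewrite /= eqxx odd_perm1.
have [c [c1 c2 c3 c4]] : exists w, data w = (true, false, false, true).
  exists (Wreath 1 [ffun=> x]); rewrite /data /= eqxx odd_perm1.
  congr (_, _, _, _).
    by apply: (forall_false _ i0); rewrite ffunE Alt_even x_odd.
  by apply/forallP=> i; rewrite ffunE Alt_even x_odd.
have [e [pe [e1 e2 e3 e4]]] :
    exists w, parity w = false /\ data w = (false, false, true, false).
  exists (Wreath s 1); rewrite parity_top /data even1 odd1.
  by rewrite /= (negPf s_neq1) s_odd.
have [f [pf [f1 f2 f3 f4]]] :
    exists w, parity w = false /\ data w = (false, true, true, false).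
  exists (Wreath t 1); rewrite parity_top /data even1 odd1.
  by rewrite /= (negPf t_neq1) t_odd.
have [g [pg [g1 g2 g3 g4]]] :
    exists w, parity w = true /\ data w = (false, true, false, false).
  exists (Wreath t (single i0 x)); rewrite parity_base // /data even_b odd_b.
  by rewrite /= (negPf t_neq1) t_odd.
pose profile (N : {set W}) :=
  [:: d \in N; b \in N; c \in N; e \in N; f \in N; g \in N].
suff: uniq (map profile (setT :: level1_types ++ level2_types)).
  exact: map_uniq.
have in_wr1 w : (w \in wr 1 'Alt_('I_m)) = (top w == 1) && even_coords w.
  by rewrite !inE.
have in_wrT w :
    (w \in wrT n m) = (top w == 1) && (even_coords w || odd_coords w).
  by rewrite inE.
rewrite /= /profile !(in_wr_full, in_wrwrA, in_wrwrB, in_wr1, in_wrT).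
rewrite !in_setT !Alt_even !in_set1.
rewrite d1 d2 d3 d4 pd b1 b2 b3 b4 pb c1 c2 c3 c4 e1 e2 e3 e4 pe f1 f2 f3 f4 pf.
rewrite g1 g2 g3 g4 pg.
by case: (parity c).
Qed.

End Types.

(** * The classification *)

Section Classification.
Variables n m : nat.
Hypotheses (n_ge3 : 2 < n) (m_ge3 : 2 < m) (n_neq4 : n != 4) (m_neq4 : m != 4).
Local Notation W := (wreath n m).
Local Notation types := (level1_types n m ++ level2_types n m).

Lemma uniq_all_types : uniq (1 :: setT :: types).
Proof.
rewrite cons_uniq uniq_types // andbT.
have /Alt_neq1[x Ax x_neq1] : 2 < #|'I_m| by rewrite card_ord.
pose i0 : 'I_n := Ordinal (ltnW (ltnW n_ge3)).
have nontrivial : Wreath 1 (single i0 x) != 1 :> W.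
  apply: contraNneq x_neq1 => /(congr1 (fun w : W => coords w i0)).
  by rewrite coords1 /= singleE eqxx => ->.
have: Wreath 1 (single i0 x) \notin (1 : {set W}) by rewrite in_set1.
apply: contra; rewrite in_cons => /predU1P[->|]; first by rewrite in_setT.
exact: types_contain_single_Alt.
Qed.

Lemma normal_subgroup_types N : normal_subgroup N = (N \in 1 :: setT :: types).
Proof.
rewrite 2!in_cons.
apply/idP/idP => [/andP[gN /andP[_ nN]] | /or3P[/eqP->|/eqP->|]].
- pose NG := Group gN.
  have [/exists_inP[w Nw w_neq1]|/exists_inPn topN] :=
      boolP [exists w in N, top w != 1].
    have [/= ->|typN] :=
      level2_normal_cases (N := NG) nN n_ge3 m_ge3 m_neq4 n_neq4 Nw w_neq1.
      by rewrite eqxx orbT.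
    by rewrite mem_cat (typN : N \in _) !orbT.
  have top1 w : w \in NG -> top w = 1 by move=> /topN; rewrite negbK => /eqP.
  have [/= ->|typN] :=
    level1_normal_cases (N := NG) nN n_ge3 m_ge3 m_neq4 top1.
    by rewrite eqxx.
  by rewrite mem_cat (typN : N \in _) !orbT.
- exact: normal_subgroup1.
- exact: normal_subgroupT.
- exact: types_normal.
Qed.

Lemma proper_normal_subgroup_types N : proper_normal_subgroup N = (N \in types).
Proof.
rewrite /proper_normal_subgroup normal_subgroup_types 2!in_cons.
have /andP[N1 /andP[NT _]] := uniq_all_types.
apply/idP/idP => [/and3P[typN /negPf N_neq1 /negPf N_neqT]|typN].
  by rewrite N_neq1 N_neqT in typN.
rewrite typN !orbT /=; apply/andP; split.
  by apply: contraNneq N1 => <-; rewrite in_cons typN orbT.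
by apply: contraNneq NT => <-.
Qed.

Lemma card_normal_subgroups : #|[set N : {set W} | normal_subgroup N]| = 10.
Proof.
rewrite (eq_card (B := mem (1 :: setT :: types))) => [|N].
  exact/card_uniqP/uniq_all_types.
by rewrite inE normal_subgroup_types.
Qed.

Lemma card_proper_normal_subgroups :
  #|[set N : {set W} | proper_normal_subgroup N]| = 8.
Proof.
rewrite (eq_card (B := mem types)) => [|N].
  by have /and3P[_ _ types_uniq] := uniq_all_types; apply/card_uniqP.
by rewrite inE proper_normal_subgroup_types.
Qed.

Lemma types_act_on_level2 N : N \in types -> acts_on_level2 N.
Proof.
have /Alt_neq1[x Ax /exists_moved[j xj]] : 2 < #|'I_m| by rewrite card_ord.
pose i0 : 'I_n := Ordinal (ltnW (ltnW n_ge3)).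
exists (Wreath 1 (single i0 x)); split=> [|i|].
- exact: types_contain_single_Alt.
- by rewrite perm1.
- by exists i0, j; rewrite /= singleE eqxx.
Qed.

Lemma level1_types_stabilize N : N \in level1_types n m -> stabilizes_level1 N.
Proof.
move=> typN w Nw i; suff -> : top w = 1 by rewrite perm1.
by move: typN Nw; rewrite !inE => /or4P[]/eqP->; rewrite inE => /andP[+ _];
   rewrite ?inE => /eqP.
Qed.

Lemma level2_types_move N : N \in level2_types n m -> ~ stabilizes_level1 N.
Proof.
move=> typN stabN.
have /Alt_neq1[s As /exists_moved[i /eqP si]] : 2 < #|'I_n| by rewrite card_ord.
exact: si (stabN _ (level2_types_contain_Alt_top As typN) i).
Qed.

End Classification.

Local Close Scope group_scope.

Theorem theorem32 (n m : nat) (hn : 3 <= n) (hm : 3 <= m)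
    (hn4 : n <> 4) (hm4 : m <> 4) :
  let Sn := [set: 'S_n]%g in
  let Sm := [set: 'S_m]%g in
  let An := ('Alt_('I_n) : {set 'S_n})%g in
  let Am := ('Alt_('I_m) : {set 'S_m})%g in
  let E := (1%g : {set 'S_n}) in
  let type1 := [:: wrwrA m E; wrT n m; wr E Sm; wr E Am] in
  let type2 := [:: wrwrA m An; wrwrA m Sn; wrwrB n m; wr An Sm] in
  [/\ (forall N : {set wreath n m},
         proper_normal_subgroup N <-> N \in type1 ++ type2),
      (forall N : {set wreath n m}, N \in type1 ->
         stabilizes_level1 N /\ acts_on_level2 N),
      (forall N : {set wreath n m}, N \in type2 ->
         ~ stabilizes_level1 N /\ acts_on_level2 N),
      (subdirect (even_base n m) /\
         (wrwrA m Sn \isog [set: Sn_ltimes_even n m])%g)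
    & #|[set N : {set wreath n m} | normal_subgroup N]| = 10 /\
      #|[set N : {set wreath n m} | proper_normal_subgroup N]| = 8].
Proof.
move: hn4 hm4 => /eqP hn4 /eqP hm4 Sn Sm An Am E type1 type2; split.
- by move=> N; rewrite (proper_normal_subgroup_types hn hm hn4 hm4).
- move=> N typN; split; first exact: level1_types_stabilize typN.
  by apply: types_act_on_level2 => //; rewrite mem_cat; apply/orP; left.
- move=> N typN; split; first exact: level2_types_move typN.
  by apply: types_act_on_level2 => //; rewrite mem_cat; apply/orP; right.
- by split; [exact: subdirect_even_base (ltnW hn) | exact: wrwrA_isog_sdprod].
- split; first exact: card_normal_subgroups.
  exact: card_proper_normal_subgroups.
Qed.
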